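(* Let $\mathcal{E}_2 \xrightarrow{P_2} \mathcal{E}_1 \xrightarrow{P_1} \mathcal{E}_0$ be a tower of two (cloven) Grothendieck fibrations, and consider the total category $(\mathcal{E}_2^{\vee_{\mathcal{E}_1}})^{\vee_{\mathcal{E}_0}}$ of its iterated dual. Its objects are the objects of $\mathcal{E}_2$. Let $\alpha,\beta$ be objects of $\mathcal{E}_2$, with $P_2(\alpha)=X$, $P_1(X)=U$, $P_2(\beta)=Y$, $P_1(Y)=V$. Then the morphisms $\alpha\to\beta$ in $(\mathcal{E}_2^{\vee_{\mathcal{E}_1}})^{\vee_{\mathcal{E}_0}}$ are in bijection with triples $(f,f^\sharp,f^{\sharp\sharp})$ where $f:U\to V$ is a morphism of $\mathcal{E}_0$; $f^\sharp : f^*Y\to X$ is a morphism of $\mathcal{E}_1$ in the fiber of $P_1$ over $U$, where $f_Y:f^*Y\to Y$ is the chosen $P_1$-cartesian lift of $f$; and $f^{\sharp\sharp} : (f^\sharp)^*\alpha \to f^*\beta$ is a morphism of $\mathcal{E}_2$ in the fiber of $P_2$ over $f^*Y$, where $(f^\sharp)^*\alpha\to\alpha$ and $f^*\beta := (f_Y)^*\beta\to\beta$ are the chosen $P_2$-cartesian lifts of $f^\sharp$ and $f_Y$.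
   Context: Fibrations are Grothendieck fibrations equipped with a choice of cartesian lifts (cloven). For a fibration $P:\mathcal{E}\to\mathcal{X}$, a morphism of $\mathcal{E}$ is in the fiber over $X$ if $P$ sends it to $\mathrm{id}_X$. Dual fibration: for a fibration $P:\mathcal{E}\to\mathcal{X}$, the dual (fiberwise opposite) $P^{\vee_{\mathcal{X}}}:\mathcal{E}^{\vee_{\mathcal{X}}}\to\mathcal{X}$ is the Grothendieck construction of the indexed category $X\mapsto (\text{fiber of }P\text{ over }X)^{\mathrm{op}}$. Explicitly, $\mathcal{E}^{\vee_{\mathcal{X}}}$ has the same objects as $\mathcal{E}$, and a morphism $E\to D$ is an equivalence class of spans $E\leftarrow\cdot\to D$ in $\mathcal{E}$ whose left leg is vertical and whose right leg is $P$-cartesian (spans identified up to isomorphism of apex commuting with the legs), composed by pullback; equivalently, a pair $(f:P(E)\to P(D),\ \psi:f^*D\to E)$ with $\psi$ in the fiber over $P(E)$. It is again a fibration over $\mathcal{X}$. The construction is functorial on cartesian-arrow-preserving functors over $\mathcal{X}$. Iterated dual of a tower of height 2: given $\mathcal{E}_2\xrightarrow{P_2}\mathcal{E}_1\xrightarrow{P_1}\mathcal{E}_0$, first form the dual fibration $P_2^{\vee_{\mathcal{E}_1}}:\mathcal{E}_2^{\vee_{\mathcal{E}_1}}\to\mathcal{E}_1$. It is a cartesian functor over $\mathcal{E}_0$ from the composite fibration $\mathcal{E}_2^{\vee_{\mathcal{E}_1}}\to\mathcal{E}_1\to\mathcal{E}_0$ to $P_1$. Then take duals over $\mathcal{E}_0$,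 obtaining $(\mathcal{E}_2^{\vee_{\mathcal{E}_1}})^{\vee_{\mathcal{E}_0}}\to\mathcal{E}_1^{\vee_{\mathcal{E}_0}}\to\mathcal{E}_0$. *)

(* Defs.v *)
From mathcomp Require Import ssreflect ssrfun ssrbool.
From Stdlib Require Import FunctionalExtensionality PropExtensionality.
From Stdlib Require Import ProofIrrelevance IndefiniteDescription.

Set Implicit Arguments.
Unset Strict Implicit.
Unset Printing Implicit Defensive.

Declare Scope cat_scope.
Delimit Scope cat_scope with cat.
Local Open Scope cat_scope.

Record category := Category {
  ob :> Type;
  hom : ob -> ob -> Type;
  idm : forall a, hom a a;
  compm : forall a b c, hom b c -> hom a b -> hom a c;
  compmA : forall a b c d (h : hom c d) (g : hom b c) (f : hom a b),
    compm h (compm g f) = compm (compm h g) f;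
  comp1m : forall a b (f : hom a b), compm (idm b) f = f;
  compm1 : forall a b (f : hom a b), compm f (idm a) = f }.

Arguments hom {c} a b : rename.
Arguments idm {c} a : rename.
Arguments compm {c a b} {c0} _ _ : rename.

Notation "g ∘ f" := (compm g f) (at level 40, left associativity) : cat_scope.

Record functor (C D : category) := Functor {
  fobj :> C -> D;
  fmap : forall a b : C, hom a b -> hom (fobj a) (fobj b);
  fmap1 : forall a : C, fmap (idm a) = idm (fobj a);
  fmapM : forall (a b c : C) (g : hom b c) (f : hom a b),
    fmap (g ∘ f) = fmap g ∘ fmap f }.

Arguments fmap {C D} P {a b} f : rename.

Program Definition functor_comp (C D E : category)
    (Q : functor D E) (P : functor C D) : functor C E :=
  @Functor C E (fun a => Q (P a)) (fun a b f => fmap Q (fmap P f)) _ _.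
Next Obligation. by rewrite !fmap1. Qed.
Next Obligation. by rewrite !fmapM. Qed.

(* Equality of arrows whose endpoints are only propositionally equal: it
   asserts the equality of the sources, of the targets and of the arrows.
   On parallel arrows it is Leibniz equality (lemma arr_eqP). *)
Inductive arr_eq (C : category) (a b : C) (f : hom a b) :
    forall a' b' : C, hom a' b' -> Prop :=
  ArrRefl : arr_eq f f.

Definition is_iso (C : category) (a b : C) (i : hom a b) : Prop :=
  exists j : hom b a, j ∘ i = idm a /\ i ∘ j = idm b.

Definition is_pullback (C : category) (a b d r : C)
    (f : hom a d) (g : hom b d) (p : hom r a) (q : hom r b) : Prop :=
  f ∘ p = g ∘ q /\
  forall (t : C) (x : hom t a) (y : hom t b), f ∘ x = g ∘ y ->
    exists! u : hom t r, p ∘ u = x /\ q ∘ u = y.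

Definition in_fiber (E X : category) (P : functor E X) (x : X)
    (a b : E) (m : hom a b) : Prop := arr_eq (fmap P m) (idm x).

Definition cartesian (E X : category) (P : functor E X)
    (a b : E) (m : hom a b) : Prop :=
  forall (e : E) (g : hom e b) (w : hom (P e) (P a)),
    fmap P m ∘ w = fmap P g ->
    exists! u : hom e a, fmap P u = w /\ m ∘ u = g.

Record fibration (E X : category) := Fibration {
  fib_functor :> functor E X;
  lift_ob : forall (d : E) (x : X), hom x (fib_functor d) -> E;
  lift : forall (d : E) (x : X) (f : hom x (fib_functor d)),
    hom (lift_ob f) d;
  lift_over : forall (d : E) (x : X) (f : hom x (fib_functor d)),
    arr_eq (fmap fib_functor (lift f)) f;
  lift_cart : forall (d : E) (x : X) (f : hom x (fib_functor d)),
    cartesian fib_functor (lift f) }.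

Arguments lift_ob {E X} P d {x} f : rename.
Arguments lift {E X} P d {x} f : rename.
Arguments lift_over {E X} P d {x} f : rename.
Arguments lift_cart {E X} P d {x} f : rename.

Section ArrEq.
Variable C : category.

Let idto (a b : C) (e : a = b) : hom a b :=
  match e in _ = b return hom a b with erefl => idm a end.

Lemma arr_eqP (a b : C) (f g : hom a b) : arr_eq f g -> f = g.
Proof.
suff H a' b' (h : hom a' b') : arr_eq f h ->
    exists (e : a = a') (e' : b = b'), idto e' ∘ f = h ∘ idto e.
  move=> /H [e [e']].
  rewrite (proof_irrelevance _ e erefl) (proof_irrelevance _ e' erefl) /=.
  by rewrite comp1m compm1.
by case; exists erefl, erefl; rewrite /= comp1m compm1.
Qed.

Lemma eq_arr (a b : C) (f g : hom a b) : f = g -> arr_eq f g.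
Proof. by move=> ->. Qed.

Lemma arr_eq_sym (a b a' b' : C) (f : hom a b) (g : hom a' b') :
  arr_eq f g -> arr_eq g f.
Proof. by case. Qed.

Lemma arr_eq_trans (a b a' b' a'' b'' : C)
    (f : hom a b) (g : hom a' b') (h : hom a'' b'') :
  arr_eq f g -> arr_eq g h -> arr_eq f h.
Proof. by move=> fg; case. Qed.

Lemma arr_eq_compr (a b c x : C) (h : hom b c) (v : hom a b) :
  arr_eq v (idm x) -> arr_eq (h ∘ v) h.
Proof.
move=> /arr_eq_sym H; case: a b v / H h => h.
by rewrite compm1.
Qed.

Lemma arr_eq_compl (a b c x : C) (v : hom b c) (h : hom a b) :
  arr_eq v (idm x) -> arr_eq (v ∘ h) h.
Proof.
move=> /arr_eq_sym H; case: b c v / H h => h.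
by rewrite comp1m.
Qed.

Lemma arr_eq_comp (a b c a' b' c' : C) (g : hom b c) (f : hom a b)
    (g' : hom b' c') (f' : hom a' b') :
  arr_eq g g' -> arr_eq f f' -> arr_eq (g ∘ f) (g' ∘ f').
Proof.
suff H b1 (eb : b = b1) (f1 : hom a b) (f2 : hom a' b1) (g1 : hom b c)
    (g2 : hom b1 c') : arr_eq g1 g2 -> arr_eq f1 f2 ->
    arr_eq (g1 ∘ f1) (g2 ∘ f2).
  move=> gg'; have eb : b = b' by case: gg'.
  by apply: H.
clear f' g'; case: b1 / eb f2 g2 => f2 g2 gg ff.
have ea : a = a' by case: ff.
have ec : c = c' by case: gg.
case: a' / ea f2 ff => f2 /arr_eqP <-.
by case: c' / ec g2 gg => g2 /arr_eqP <-.
Qed.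

Lemma arr_eq_dom (a b a' b' : C) (f : hom a b) (g : hom a' b') :
  arr_eq f g -> a = a'.
Proof. by case. Qed.

Lemma recast_arr (a b a' b' : C) (h : hom a b) : a = a' -> b = b' ->
  exists h' : hom a' b', arr_eq h h'.
Proof. by move=> <- <-; exists h. Qed.

Lemma arr_eq_id (a b x : C) (v : hom a b) : arr_eq v (idm x) ->
  arr_eq v (idm a) /\ arr_eq v (idm b).
Proof. by move=> /arr_eq_sym []. Qed.

End ArrEq.

Lemma fmap_arr_eq (C D : category) (P : functor C D) (a b a' b' : C)
    (f : hom a b) (g : hom a' b') :
  arr_eq f g -> arr_eq (fmap P f) (fmap P g).
Proof. by case. Qed.

Lemma cartesian_arr_eq (C D : category) (P : functor C D) (a b a' b' : C)
    (f : hom a b) (g : hom a' b') :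
  arr_eq f g -> cartesian P f -> cartesian P g.
Proof. by case. Qed.

Section Iso.
Variable C : category.

Lemma iso_id (a : C) : is_iso (idm a).
Proof. by exists (idm a); rewrite comp1m. Qed.

Lemma iso_comp (a b c : C) (g : hom b c) (f : hom a b) :
  is_iso g -> is_iso f -> is_iso (g ∘ f).
Proof.
move=> [g' [g1 g2]] [f' [f1 f2]]; exists (f' ∘ g'); split.
  by rewrite compmA -(compmA f') g1 compm1.
by rewrite compmA -(compmA g) f2 compm1.
Qed.

Lemma pullback_uniq (a b d r r' : C) (f : hom a d) (g : hom b d)
    (p : hom r a) (q : hom r b) (p' : hom r' a) (q' : hom r' b) :
  is_pullback f g p q -> is_pullback f g p' q' ->
  exists i : hom r r', [/\ is_iso i, p' ∘ i = p & q' ∘ i = q].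
Proof.
move=> [sq U] [sq' U'].
case: (U' _ _ _ sq) => i [[i1 i2] _].
case: (U _ _ _ sq') => j [[j1 j2] _].
exists i; split=> //; exists j; split.
  case: (U _ _ _ sq) => k [_ K].
  rewrite -(K (j ∘ i)); first by rewrite (K (idm _)) // !compm1.
  by rewrite !compmA j1 j2.
case: (U' _ _ _ sq') => k [_ K].
rewrite -(K (i ∘ j)); first by rewrite (K (idm _)) // !compm1.
by rewrite !compmA i1 i2.
Qed.

Lemma pullback_iso (a b d r a' b' : C) (f : hom a d) (g : hom b d)
    (p : hom r a') (q : hom r b') (i : hom a' a) (j : hom b' b) :
  is_iso i -> is_iso j ->
  is_pullback (f ∘ i) (g ∘ j) p q -> is_pullback f g (i ∘ p) (j ∘ q).
Proof.
move=> [i' [i1 i2]] [j' [j1 j2]] [sq U]; split; first by rewrite !compmA.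
move=> t x y xy.
have [|u [[u1 u2] uU]] := U t (i' ∘ x) (j' ∘ y).
  by rewrite !compmA -!(compmA _ _ i') -!(compmA _ _ j') i2 j2 !compm1.
exists u; split; first by rewrite -!compmA u1 u2 !compmA i2 j2 !comp1m.
move=> v [v1 v2]; apply: uU; rewrite -v1 -v2.
by rewrite -!compmA (compmA i') (compmA j') i1 j1 !comp1m.
Qed.

Lemma pullback_precomp (a b d r r' : C) (f : hom a d) (g : hom b d)
    (p : hom r a) (q : hom r b) (i : hom r' r) :
  is_iso i -> is_pullback f g p q -> is_pullback f g (p ∘ i) (q ∘ i).
Proof.
move=> [i' [i1 i2]] [sq U]; split; first by rewrite !compmA sq.
move=> t x y xy; have [u [[u1 u2] uU]] := U _ _ _ xy.
exists (i' ∘ u); split.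
  by rewrite -!compmA !(compmA i) i2 comp1m.
move=> v; rewrite -!compmA => /uU ->.
by rewrite compmA i1 comp1m.
Qed.

Lemma pullback_idl (a d : C) (g : hom a d) :
  is_pullback (idm d) g g (idm a).
Proof.
split=> [|t x y]; first by rewrite comp1m compm1.
rewrite comp1m => ->; exists y; split; first by rewrite comp1m.
by move=> u [_ <-]; rewrite comp1m.
Qed.

Lemma pullback_sym (a b d r : C) (f : hom a d) (g : hom b d)
    (p : hom r a) (q : hom r b) :
  is_pullback f g p q -> is_pullback g f q p.
Proof.
move=> [sq U]; split=> // t x y xy.
have [u [[u1 u2] uU]] := U _ _ _ (esym xy).
by exists u; split=> // v [v1 v2]; apply: uU.
Qed.

Lemma pullback_idr (a d : C) (g : hom a d) :
  is_pullback g (idm d) (idm a) g.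
Proof. exact: pullback_sym (pullback_idl g). Qed.

Lemma pullback_paste (a b d r c s : C) (f : hom a d) (g : hom b d)
    (p : hom r a) (q : hom r b) (h : hom c b) (p' : hom s r) (q' : hom s c) :
  is_pullback f g p q -> is_pullback q h p' q' ->
  is_pullback f (g ∘ h) (p ∘ p') q'.
Proof.
move=> [sq U] [sq' U']; split.
  by rewrite compmA sq -compmA sq' compmA.
move=> t x y; rewrite -compmA => xy.
have [u [[u1 u2] uU]] := U _ _ _ xy.
have [v [[v1 v2] vU]] := U' _ _ _ u2.
exists v; split; first by rewrite -compmA v1.
move=> w [w1 w2]; apply: vU; split=> //.
apply/esym/uU; split; first by rewrite compmA.
by rewrite compmA sq' -compmA w2.
Qed.

End Iso.

Section Cartesian.
Variables (E X : category) (P : functor E X).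

Lemma cart_inj (a b e : E) (m : hom a b) (u v : hom e a) : cartesian P m ->
  m ∘ u = m ∘ v -> fmap P u = fmap P v -> u = v.
Proof.
move=> cm uv Puv.
have [|w [_ wU]] := cm e (m ∘ v) (fmap P v); first by rewrite fmapM.
by rewrite -(wU u) ?(wU v).
Qed.

Lemma cart_id (a : E) : cartesian P (idm a).
Proof.
move=> e g w; rewrite fmap1 comp1m => ->; exists g; split.
  by rewrite comp1m.
by move=> u [_ <-]; rewrite comp1m.
Qed.

Lemma cart_comp (a b c : E) (g : hom b c) (f : hom a b) :
  cartesian P g -> cartesian P f -> cartesian P (g ∘ f).
Proof.
move=> cg cf e h w; rewrite fmapM -compmA => hw.
have [u [[u1 u2] uU]] := cg _ _ _ hw.
have [v [[v1 v2] vU]] := cf _ _ _ (esym u1).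
exists v; split; first by rewrite -compmA v2.
move=> x [x1 x2]; apply: vU; split=> //.
by apply/esym/uU; rewrite fmapM x1 compmA.
Qed.

Lemma cart_cancel (a b c : E) (g : hom b c) (f : hom a b) :
  cartesian P g -> cartesian P (g ∘ f) -> cartesian P f.
Proof.
move=> cg cgf e h w hw.
have [|u [[u1 u2] uU]] := cgf e (g ∘ h) w.
  by rewrite !fmapM -compmA hw.
exists u; split; first split=> //.
  apply: (cart_inj cg); first by rewrite compmA.
  by rewrite fmapM u1.
by move=> v [v1 v2]; apply: uU; rewrite -compmA v2.
Qed.

End Cartesian.

Section Pullbacks.
Variables (E X : category) (P : fibration E X).

(* [xv] is arbitrary: it is forced to be the object under [v]. *)
Lemma cart_vert_pullback (a b d : E) (c : hom a d) (v : hom b d) (xv : X) :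
  cartesian P c -> in_fiber P xv v ->
  exists (r : E) (p : hom r a) (q : hom r b),
    [/\ is_pullback c v p q, in_fiber P (P a) p & cartesian P q].
Proof.
move=> cc vv.
have [_ vd] := arr_eq_id vv.
have [f cf] := recast_arr (fmap P c) erefl (esym (arr_eq_dom vd)).
pose q := lift P b f.
have qf : arr_eq (fmap P q) f := lift_over P b f.
have qc : arr_eq (fmap P q) (fmap P c) := arr_eq_trans qf (arr_eq_sym cf).
have [w ww] := recast_arr (idm (P a)) (esym (arr_eq_dom qf)) erefl.
have ww' := arr_eq_sym ww.
have [|p [[p1 p2] _]] := cc _ (v ∘ q) w.
  apply: arr_eqP; apply: arr_eq_trans (arr_eq_compr _ ww') _.
  apply: arr_eq_sym; rewrite fmapM.
  exact: arr_eq_trans (arr_eq_compl _ vv) qc.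
have pv : in_fiber P (P a) p by rewrite /in_fiber p1.
exists (lift_ob P b f), p, q; split=> //; last exact: lift_cart.
split=> // t x y xy.
have [w' ww1] := recast_arr (fmap P x) erefl (esym (arr_eq_dom qf)).
have [|u [[u1 u2] uU]] := lift_cart P b f _ y w'.
  apply: arr_eqP; apply: arr_eq_trans (arr_eq_comp qc (arr_eq_sym ww1)) _.
  rewrite -fmapM xy fmapM; exact: arr_eq_compl vv.
exists u; split; first split=> //.
  apply: (cart_inj cc); first by rewrite compmA p2 -compmA u2.
  rewrite fmapM u1; apply: arr_eqP.
  exact: arr_eq_trans (arr_eq_compl _ pv) (arr_eq_sym ww1).
move=> u' [x' y']; apply: uU; split=> //; apply: arr_eqP.
apply: arr_eq_trans _ ww1; rewrite -x' fmapM.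
exact: arr_eq_sym (arr_eq_compl _ pv).
Qed.

End Pullbacks.

Section CompositeFibration.
Variables (E X B : category) (Q : fibration X B) (P : fibration E X).

Lemma functor_comp_cart (a b : E) (m : hom a b) :
  cartesian P m -> cartesian Q (fmap P m) -> cartesian (functor_comp Q P) m.
Proof.
move=> cm cPm e g w /= /cPm [u [[u1 u2] uU]].
have [v [[v1 v2] vU]] := cm _ _ _ u2.
exists v; split; first by rewrite v1.
move=> x [x1 x2]; apply: vU; split=> //.
by apply/esym/uU; rewrite -fmapM x2.
Qed.

Definition comp_lift_ob (d : E) (u : B) (f : hom u (Q (P d))) : E :=
  lift_ob P d (lift Q (P d) f).

Definition comp_lift (d : E) (u : B) (f : hom u (Q (P d))) :
  hom (comp_lift_ob f) d := lift P d (lift Q (P d) f).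

Lemma comp_lift_over (d : E) (u : B) (f : hom u (Q (P d))) :
  arr_eq (fmap (functor_comp Q P) (comp_lift f)) f.
Proof.
exact: arr_eq_trans (fmap_arr_eq Q (lift_over P d _)) (lift_over Q _ f).
Qed.

Lemma comp_lift_cart (d : E) (u : B) (f : hom u (Q (P d))) :
  cartesian (functor_comp Q P) (comp_lift f).
Proof.
apply: functor_comp_cart; first exact: lift_cart.
by apply: cartesian_arr_eq (arr_eq_sym (lift_over P d _)) _; apply: lift_cart.
Qed.

Definition fibration_comp : fibration E B :=
  @Fibration E B (functor_comp Q P) comp_lift_ob comp_lift
    comp_lift_over comp_lift_cart.

End CompositeFibration.

Section Dual.
Variables (E X : category) (P : fibration E X).

Record span (e d : E) := Span {
  apex : E;
  lleg : hom apex e;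
  rleg : hom apex d;
  lleg_vert : in_fiber P (P e) lleg;
  rleg_cart : cartesian P rleg }.

Arguments lleg_vert {e d} s.
Arguments rleg_cart {e d} s.

Definition span_iso (e d : E) (s t : span e d) : Prop :=
  exists i : hom (apex s) (apex t),
    [/\ is_iso i, lleg t ∘ i = lleg s & rleg t ∘ i = rleg s].

(* A morphism of the dual is an equivalence class of spans, represented as a
   set of spans. *)
Definition dual_hom (e d : E) : Type :=
  {c : span e d -> Prop | exists s, c = span_iso s}.

Definition span_class (e d : E) (s : span e d) : dual_hom e d :=
  exist _ (span_iso s) (ex_intro _ s erefl).

Definition id_span (e : E) : span e e :=
  @Span e e e (idm e) (idm e) (eq_arr (fmap1 P e)) (cart_id (P := P) (a := e)).

Definition dual_comp_spans (a b c : E)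
    (n : dual_hom b c) (m : dual_hom a b) (r : span a c) : Prop :=
  exists (s : span a b) (t : span b c)
         (p : hom (apex r) (apex s)) (q : hom (apex r) (apex t)),
    [/\ sval m s, sval n t, is_pullback (rleg s) (lleg t) p q,
        lleg r = lleg s ∘ p & rleg r = rleg t ∘ q].

Lemma span_iso_refl (e d : E) (s : span e d) : span_iso s s.
Proof. by exists (idm _); rewrite !compm1; split=> //; apply: iso_id. Qed.

Lemma span_iso_sym (e d : E) (s t : span e d) : span_iso s t -> span_iso t s.
Proof.
move=> [i [[j [ji ij]] il ir]]; exists j.
by split; [exists i | rewrite -?il -?ir -compmA ij compm1 ..].
Qed.

Lemma span_iso_trans (e d : E) (s t u : span e d) :
  span_iso s t -> span_iso t u -> span_iso s u.
Proof.
move=> [i [ii il ir]] [j [jj jl jr]]; exists (j ∘ i).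
by rewrite !compmA jl jr; split=> //; apply: iso_comp.
Qed.

Lemma dual_hom_eq (e d : E) (m n : dual_hom e d) : sval m = sval n -> m = n.
Proof.
case: m n => [c cP] [c' cP'] /= e1.
by case: c' / e1 cP' => cP'; rewrite (proof_irrelevance _ cP cP').
Qed.

Lemma span_class_eqP (e d : E) (s t : span e d) :
  span_class s = span_class t <-> span_iso s t.
Proof.
split=> [/(congr1 sval) /= ->|st]; first exact: span_iso_refl.
apply: dual_hom_eq; apply: functional_extensionality => u /=.
apply: propositional_extensionality; split.
  exact: span_iso_trans (span_iso_sym st).
exact: span_iso_trans st.
Qed.

Lemma span_class_surj (e d : E) (m : dual_hom e d) :
  exists s, m = span_class s.
Proof. by case: (svalP m) => s ms; exists s; apply: dual_hom_eq. Qed.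

Lemma dual_comp_spansE (a b c : E) (s : span a b) (t : span b c)
    (r : span a c) (p : hom (apex r) (apex s)) (q : hom (apex r) (apex t)) :
  is_pullback (rleg s) (lleg t) p q ->
  lleg r = lleg s ∘ p -> rleg r = rleg t ∘ q ->
  dual_comp_spans (span_class t) (span_class s) = span_iso r.
Proof.
move=> pb rl rr; apply: functional_extensionality => r'.
apply: propositional_extensionality; split; last first.
  move=> /span_iso_sym [i [ii il ir]]; exists s, t, (p ∘ i), (q ∘ i).
  split; rewrite ?compmA -?rl -?rr //; try exact: span_iso_refl.
  exact: pullback_precomp.
move=> [s' [t' [p' [q' [/span_iso_sym [i [ii il ir]]
  /span_iso_sym [j [jj jl jr]] pb' rl' rr']]]]].
rewrite -ir -jl in pb'.
have [k [kk k1 k2]] := pullback_uniq pb (pullback_iso ii jj pb').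
exists k; split=> //.
  by rewrite rl' -il -!compmA (compmA i) k1 rl.
by rewrite rr' -jr -!compmA (compmA j) k2 rr.
Qed.

Lemma span_pullback (a b c : E) (s : span a b) (t : span b c) :
  exists (r : span a c) (p : hom (apex r) (apex s)) (q : hom (apex r) (apex t)),
    [/\ is_pullback (rleg s) (lleg t) p q,
        lleg r = lleg s ∘ p, rleg r = rleg t ∘ q &
        in_fiber P (P (apex s)) p /\ cartesian P q].
Proof.
have [r [p [q [pb pv qc]]]] :=
  cart_vert_pullback (rleg_cart s) (lleg_vert t).
have lv : in_fiber P (P a) (lleg s ∘ p).
  rewrite /in_fiber fmapM.
  exact: arr_eq_trans (arr_eq_compr _ pv) (lleg_vert s).
by exists (Span lv (cart_comp (rleg_cart t) qc)), p, q.
Qed.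

Lemma dual_comp_subproof (a b c : E) (n : dual_hom b c) (m : dual_hom a b) :
  exists r, dual_comp_spans n m = span_iso r.
Proof.
have [s ->] := span_class_surj m; have [t ->] := span_class_surj n.
have [r [p [q [pb rl rr _]]]] := span_pullback s t.
by exists r; apply: dual_comp_spansE pb rl rr.
Qed.

Definition dual_comp (a b c : E) (n : dual_hom b c) (m : dual_hom a b) :
  dual_hom a c := exist _ (dual_comp_spans n m) (dual_comp_subproof n m).

Definition dual_id (e : E) : dual_hom e e := span_class (id_span e).

Lemma dual_compE (a b c : E) (s : span a b) (t : span b c)
    (r : span a c) (p : hom (apex r) (apex s)) (q : hom (apex r) (apex t)) :
  is_pullback (rleg s) (lleg t) p q ->
  lleg r = lleg s ∘ p -> rleg r = rleg t ∘ q ->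
  dual_comp (span_class t) (span_class s) = span_class r.
Proof.
by move=> pb rl rr; apply: dual_hom_eq; apply: dual_comp_spansE pb rl rr.
Qed.

Lemma dual_comp1m (a b : E) (m : dual_hom a b) : dual_comp (dual_id b) m = m.
Proof.
have [s ->] := span_class_surj m.
apply: (@dual_compE _ _ _ s (id_span b) s (idm _) (rleg s)).
- exact: pullback_idr.
- by rewrite compm1.
- by rewrite comp1m.
Qed.

Lemma dual_compm1 (a b : E) (m : dual_hom a b) : dual_comp m (dual_id a) = m.
Proof.
have [s ->] := span_class_surj m.
apply: (@dual_compE _ _ _ (id_span a) s s (lleg s) (idm _)).
- exact: pullback_idl.
- by rewrite comp1m.
- by rewrite compm1.
Qed.

Lemma dual_compA (a b c d : E) (o : dual_hom c d) (n : dual_hom b c)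
    (m : dual_hom a b) :
  dual_comp o (dual_comp n m) = dual_comp (dual_comp o n) m.
Proof.
have [s ->] := span_class_surj m; have [t ->] := span_class_surj n.
have [u ->] := span_class_surj o.
have [r [p [q [pb rl rr [pv qc]]]]] := span_pullback s t.
have [r' [p' [q' [pb' rl' rr' [pv' qc']]]]] := span_pullback t u.
rewrite (dual_compE pb rl rr) (dual_compE pb' rl' rr').
have [w [x [y [pbw xv yc]]]] := cart_vert_pullback qc pv'.
have lv : in_fiber P (P a) (lleg r ∘ x).
  rewrite /in_fiber fmapM.
  exact: arr_eq_trans (arr_eq_compr _ xv) (lleg_vert r).
pose z := Span lv (cart_comp (rleg_cart r') yc).
rewrite (@dual_compE _ _ _ r u z x (q' ∘ y)) //=; first last.
- by rewrite rr' compmA.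
- rewrite rr; apply: pullback_sym.
  by apply: pullback_paste (pullback_sym pb') (pullback_sym pbw).
rewrite (@dual_compE _ _ _ s r' z (p ∘ x) y) //=.
- by rewrite rl'; apply: pullback_paste pb pbw.
- by rewrite rl compmA.
Qed.

Definition dual : category :=
  @Category E dual_hom dual_id dual_comp dual_compA dual_comp1m dual_compm1.

(* The legs of a span representing m determine the same arrow of X, up to the
   equality of the objects under the apex and under the source. *)
Definition dual_base (e d : E) (m : dual_hom e d) (h : hom (P e) (P d)) :=
  exists s, m = span_class s /\ arr_eq (fmap P (rleg s)) h.

Lemma dual_base_exists (e d : E) (m : dual_hom e d) : exists h, dual_base m h.
Proof.
have [s ->] := span_class_surj m.
have [_ /arr_eq_dom ae] := arr_eq_id (lleg_vert s).
have [h hs] := recast_arr (fmap P (rleg s)) ae erefl.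
by exists h, s.
Qed.

Definition dual_fmap (e d : E) (m : dual_hom e d) : hom (P e) (P d) :=
  sval (constructive_indefinite_description _ (dual_base_exists m)).

Lemma iso_vert (a b e : E) (i : hom a b) (v : hom b e) (v' : hom a e) (x : X) :
  in_fiber P x v -> in_fiber P x v' -> v ∘ i = v' -> in_fiber P x i.
Proof.
move=> vv vv' vi; rewrite /in_fiber; apply: arr_eq_trans _ vv'.
by rewrite -vi fmapM; apply: arr_eq_sym; apply: arr_eq_compl vv.
Qed.

Lemma dual_fmapE (e d : E) (s : span e d) :
  arr_eq (fmap P (rleg s)) (dual_fmap (span_class s)).
Proof.
rewrite /dual_fmap; case: constructive_indefinite_description => h /=.
move=> [t [/span_class_eqP [i [ii il ir]]]]; apply: arr_eq_trans.
rewrite -ir fmapM; apply: arr_eq_compr.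
exact: (iso_vert (lleg_vert t) (lleg_vert s) il).
Qed.

Lemma dual_fmap1 (e : E) : dual_fmap (idm (e : dual)) = idm (P e).
Proof.
apply/arr_eqP/arr_eq_sym; apply: arr_eq_trans (dual_fmapE (id_span e)).
by rewrite /= fmap1.
Qed.

Lemma dual_fmapM (a b c : dual) (n : hom b c) (m : hom a b) :
  dual_fmap (n ∘ m) = dual_fmap n ∘ dual_fmap m.
Proof.
have [s ->] := span_class_surj m; have [t ->] := span_class_surj n.
have [r [p [q [pb rl rr [pv qc]]]]] := span_pullback s t.
rewrite /= (dual_compE pb rl rr); apply/arr_eqP/arr_eq_sym.
apply: arr_eq_trans (dual_fmapE r); rewrite rr fmapM.
apply: arr_eq_comp; first exact: arr_eq_sym (dual_fmapE t).
apply: arr_eq_trans (arr_eq_sym (dual_fmapE s)) _.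
have sq : fmap P (rleg s) ∘ fmap P p = fmap P (lleg t) ∘ fmap P q.
  by rewrite -!fmapM pb.1.
apply: arr_eq_trans (arr_eq_sym (arr_eq_compr (fmap P (rleg s)) pv)) _.
by rewrite sq; apply: arr_eq_compl (lleg_vert t).
Qed.

Definition dual_functor : functor dual X :=
  @Functor dual X P dual_fmap dual_fmap1 dual_fmapM.

Definition cart_span (e d : E) (c : hom e d) (cc : cartesian P c) : span e d :=
  @Span e d e (idm e) c (eq_arr (fmap1 P e)) cc.

Lemma cart_span_comp (e a b : E) (c : hom a b) (cc : cartesian P c)
    (s : span e a) :
  dual_comp (span_class (cart_span cc)) (span_class s) =
  span_class (Span (lleg_vert s) (cart_comp cc (rleg_cart s))).
Proof.
pose r := Span (lleg_vert s) (cart_comp cc (rleg_cart s)).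
apply: (@dual_compE _ _ _ s (cart_span cc) r (idm _) (rleg s)) => //=.
- exact: pullback_idr.
- by rewrite compm1.
Qed.

Lemma cart_span_cart (a b : E) (c : hom a b) (cc : cartesian P c) :
  @cartesian dual X dual_functor a b (span_class (cart_span cc)).
Proof.
move=> e g w /=; have [s ->] := span_class_surj g => ws.
have cE : dual_fmap (span_class (cart_span cc)) = fmap P c.
  by apply/arr_eqP/arr_eq_sym; apply: (dual_fmapE (cart_span cc)).
have [w' ww'] := recast_arr w
  (esym (arr_eq_dom (arr_eq_id (lleg_vert s)).2)) erefl.
have [|x [[x1 x2] xU]] := cc _ (rleg s) w'.
  apply: arr_eqP; apply: arr_eq_trans (arr_eq_sym (dual_fmapE s)).
  rewrite -ws cE; exact: arr_eq_comp (ArrRefl _) (arr_eq_sym ww').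
have cx : cartesian P x.
  by apply: (cart_cancel cc); rewrite x2; apply: rleg_cart.
exists (span_class (Span (lleg_vert s) cx)); split.
  split.
    apply/arr_eqP/(arr_eq_trans (arr_eq_sym (dual_fmapE _))).
    by rewrite /= x1; apply: arr_eq_sym.
  rewrite cart_span_comp; apply/span_class_eqP; exists (idm _) => /=.
  by split; rewrite ?compm1 //; apply: iso_id.
move=> u; have [t ->] := span_class_surj u; rewrite cart_span_comp.
move=> [tw /span_class_eqP [i [/= ii il ir]]]; apply/span_class_eqP.
apply: span_iso_sym; exists i; split=> //=.
apply: (cart_inj cc); first by rewrite compmA x2.
rewrite fmapM x1; apply: arr_eqP.
apply: arr_eq_trans (arr_eq_compr _ (iso_vert (lleg_vert s) (lleg_vert t) il)) _.
apply: arr_eq_trans (arr_eq_sym ww') _; rewrite -tw.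
exact: arr_eq_sym (dual_fmapE t).
Qed.

Definition dual_lift_ob (d : dual) (x : X) (f : hom x (dual_functor d)) : dual :=
  lift_ob P d f.

Definition dual_lift (d : dual) (x : X) (f : hom x (dual_functor d)) :
  hom (dual_lift_ob f) d := span_class (cart_span (lift_cart P d f)).

Lemma dual_lift_over (d : dual) (x : X) (f : hom x (dual_functor d)) :
  arr_eq (fmap dual_functor (dual_lift f)) f.
Proof.
apply: arr_eq_trans (arr_eq_sym (dual_fmapE _)) _; exact: lift_over.
Qed.

Lemma dual_lift_cart (d : dual) (x : X) (f : hom x (dual_functor d)) :
  cartesian dual_functor (dual_lift f).
Proof. exact: cart_span_cart. Qed.

Definition dual_fibration : fibration dual X :=
  @Fibration dual X dual_functor dual_lift_ob dual_lift
    dual_lift_over dual_lift_cart.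

End Dual.

Section IteratedDual.
Variables (E2 E1 E0 : category) (P2 : fibration E2 E1) (P1 : fibration E1 E0).

Definition iterated_dual : category :=
  dual (fibration_comp P1 (dual_fibration P2)).

(* f : U -> V,  f# : f^*Y -> X over U,  f## : (f#)^*alpha -> f^*beta over f^*Y,
   where X = P2 alpha, U = P1 X, Y = P2 beta, V = P1 Y. *)
Record triple (alpha beta : E2) := Triple {
  tri0 : hom (P1 (P2 alpha)) (P1 (P2 beta));
  tri1 : hom (lift_ob P1 (P2 beta) tri0) (P2 alpha);
  tri1_vert : in_fiber P1 (P1 (P2 alpha)) tri1;
  tri2 : hom (lift_ob P2 alpha tri1)
             (lift_ob P2 beta (lift P1 (P2 beta) tri0));
  tri2_vert : in_fiber P2 (lift_ob P1 (P2 beta) tri0) tri2 }.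

Section HomOfTriple.
Variables (alpha beta : E2) (t : triple alpha beta).

Let apex_ob : E2 := lift_ob P2 beta (lift P1 (P2 beta) (tri0 t)).

Lemma tri2_in_fiber : in_fiber P2 (P2 apex_ob) (tri2 t).
Proof. exact: (arr_eq_id (tri2_vert t)).2. Qed.

(* The span  f^*beta <- (f#)^*alpha -> alpha  in E2. *)
Definition triple_lleg_span : span P2 apex_ob alpha :=
  Span tri2_in_fiber (lift_cart P2 alpha (tri1 t)).

Definition triple_lleg : @hom (dual P2) apex_ob alpha :=
  span_class triple_lleg_span.

Definition triple_rleg : @hom (dual P2) apex_ob beta :=
  lift (fibration_comp P1 (dual_fibration P2)) beta (tri0 t).

Lemma triple_lleg_vert :
  in_fiber (fibration_comp P1 (dual_fibration P2))
    (P1 (P2 alpha)) triple_lleg.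
Proof.
have h : arr_eq (dual_fmap triple_lleg) (tri1 t).
  apply: arr_eq_trans (arr_eq_sym (dual_fmapE triple_lleg_span)) _.
  exact: lift_over.
exact: arr_eq_trans (fmap_arr_eq P1 h) (tri1_vert t).
Qed.

Lemma triple_rleg_cart :
  cartesian (fibration_comp P1 (dual_fibration P2)) triple_rleg.
Proof. exact: lift_cart. Qed.

(* The span  alpha <- f^*beta -> beta  in the dual of P2, whose left leg is
   given by f# and f##, and whose right leg is the chosen lift of f. *)
Definition triple_span :
    span (fibration_comp P1 (dual_fibration P2)) alpha beta :=
  @Span _ _ (fibration_comp P1 (dual_fibration P2)) alpha beta
    apex_ob triple_lleg triple_rleg triple_lleg_vert triple_rleg_cart.

Definition hom_of_triple : @hom iterated_dual alpha beta :=
  span_class triple_span.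

End HomOfTriple.
End IteratedDual.

(* Main.v *)
Require Import Defs.
From mathcomp Require Import ssreflect ssrfun ssrbool.
From Stdlib Require Import ProofIrrelevance IndefiniteDescription.

(** Since a chosen lift is cartesian, a span whose right leg is cartesian over
    [h] is isomorphic to one whose right leg is the chosen lift of [h], and the
    isomorphism is unique.  Normalising first the right leg of a span of the
    outer dual, and then the right leg of a span of [P2] representing its left
    leg, leaves exactly the data of a triple. *)

Set Implicit Arguments.
Unset Strict Implicit.
Unset Printing Implicit Defensive.

Local Open Scope cat_scope.

Section CartesianUniqueness.
Variables (E X : category) (P : functor E X).

Lemma in_fiber_eq (a b : E) (m : hom a b) (x y : X) :
  x = y -> in_fiber P x m -> in_fiber P y m.
Proof. by move=> ->. Qed.

Lemma cart_factor_vert (a a' b : E) (m : hom a b) (m' : hom a' b) :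
  cartesian P m -> arr_eq (fmap P m) (fmap P m') ->
  exists i : hom a' a, m ∘ i = m' /\ in_fiber P (P a) i.
Proof.
move=> cm mm'.
(* [P a] and [P a'] are only propositionally equal, so the identity to be lifted is recast as an
   arrow from [P a'] to [P a]. *)
have [w ww] := recast_arr (idm (P a)) (arr_eq_dom mm') erefl.
have [|i [[i1 i2] _]] := cm _ m' w.
  apply: arr_eqP; apply: arr_eq_trans mm'.
  exact: arr_eq_compr (arr_eq_sym ww).
by exists i; rewrite /in_fiber i1; split=> //; apply: arr_eq_sym.
Qed.

Lemma cart_vert_endo (a b : E) (m : hom a b) (i : hom a a) (x : X) :
  cartesian P m -> m ∘ i = m -> in_fiber P x i -> i = idm a.
Proof.
move=> cm mi vi; apply: (cart_inj cm); first by rewrite compm1.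
by rewrite fmap1; apply: arr_eqP; apply: (arr_eq_id vi).1.
Qed.

Lemma cart_uniq_iso (a a' b : E) (m : hom a b) (m' : hom a' b) :
  cartesian P m -> cartesian P m' -> arr_eq (fmap P m) (fmap P m') ->
  exists i : hom a' a, [/\ is_iso i, m ∘ i = m' & in_fiber P (P a) i].
Proof.
move=> cm cm' mm'.
have [i [mi vi]] := cart_factor_vert cm mm'.
have [j [mj vj]] := cart_factor_vert cm' (arr_eq_sym mm').
exists i; split=> //; exists j; split.
  apply: (cart_vert_endo (x := P a') cm'); first by rewrite compmA mj.
  by rewrite /in_fiber fmapM; apply: arr_eq_trans (arr_eq_compl _ vj)
    (arr_eq_id vi).1.
apply: (cart_vert_endo (x := P a) cm); first by rewrite compmA mi.
by rewrite /in_fiber fmapM; apply: arr_eq_trans (arr_eq_compl _ vi)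
  (arr_eq_id vj).1.
Qed.

End CartesianUniqueness.

Section DualNormalForm.
Variables (E X : category) (P : fibration E X).

(** Existence half of the normal form: the vertical comparison isomorphism from [a] to the apex of
    any representative is absorbed into the left leg. *)
Lemma span_class_rlegP (e d a : E) (m : dual_hom P e d) (r : hom a d) :
  cartesian P r -> arr_eq (fmap P r) (dual_fmap m) ->
  exists s : hom a e, exists vs : in_fiber P (P e) s,
  exists cr : cartesian P r, m = span_class (Span vs cr).
Proof.
move=> cr; have [t ->] := span_class_surj m => rt.
have [|i [ii ti vi]] := cart_uniq_iso (rleg_cart (s := t)) cr.
  exact: arr_eq_trans (dual_fmapE t) (arr_eq_sym rt).
have vs : in_fiber P (P e) (lleg t ∘ i).
  rewrite /in_fiber fmapM.
  exact: arr_eq_trans (arr_eq_compr _ vi) (lleg_vert t).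
exists (lleg t ∘ i), vs, cr; apply/span_class_eqP/span_iso_sym.
by exists i.
Qed.

(** Uniqueness half: an isomorphism of the two spans is vertical because both left legs are, and it
    fixes the cartesian [r], so it is the identity. *)
Lemma span_class_lleg_inj (e d a : E) (s s' : hom a e) (r : hom a d)
    (vs : in_fiber P (P e) s) (vs' : in_fiber P (P e) s')
    (cr cr' : cartesian P r) :
  span_class (Span vs cr) = span_class (Span vs' cr') -> s = s'.
Proof.
move=> /span_class_eqP [i [/= ii si ri]].
suff i1 : i = idm a by rewrite -si i1 compm1.
exact: cart_vert_endo cr ri (iso_vert vs' vs si).
Qed.

End DualNormalForm.

Section Bijection.
Variables (E2 E1 E0 : category) (P2 : fibration E2 E1) (P1 : fibration E1 E0).
Variables alpha beta : E2.

Let Q := fibration_comp P1 (dual_fibration P2).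

(** Makes [tri0] recoverable from the class alone, since the base arrow does not depend on the
    representative. *)
Lemma tri0E (t : triple P2 P1 alpha beta) :
  arr_eq (tri0 t) (dual_fmap (P := Q) (hom_of_triple t)).
Proof.
apply: arr_eq_trans (dual_fmapE (P := Q) (triple_span t)).
exact: arr_eq_sym (lift_over Q beta (tri0 t)).
Qed.

Lemma tri1E (t : triple P2 P1 alpha beta) :
  arr_eq (tri1 t) (dual_fmap (triple_lleg t)).
Proof.
apply: arr_eq_trans (dual_fmapE (triple_lleg_span t)).
exact: arr_eq_sym (lift_over P2 alpha (tri1 t)).
Qed.

Lemma hom_of_triple_inj :
  injective (@hom_of_triple E2 E1 E0 P2 P1 alpha beta).
Proof.
move=> t t' tt'.
have e0 : tri0 t = tri0 t'.
  apply/arr_eqP/(arr_eq_trans (tri0E t)); rewrite tt'.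
  exact: arr_eq_sym (tri0E t').
case: t t' tt' e0 => [f g vg h vh] [f' g' vg' h' vh'] tt' /= e0.
(* Once the base arrows are identified, both outer spans have the same chosen lift as right leg, so
   their left legs can be compared. *)
case: f' / e0 g' vg' h' vh' tt' => g' vg' h' vh' tt'.
have ll := span_class_lleg_inj tt'.
have e1 : g = g'.
  apply/arr_eqP/(arr_eq_trans (tri1E (Triple vg vh))); rewrite ll.
  exact: arr_eq_sym (tri1E (Triple vg' vh')).
case: g' / e1 vg' h' vh' ll {tt'} => vg' h' vh' ll.
have e2 : h = h' := span_class_lleg_inj ll.
case: h' / e2 vh' {ll} => vh'.
by rewrite (proof_irrelevance _ vg' vg) (proof_irrelevance _ vh' vh).
Qed.

Lemma hom_of_triple_surj (m : @hom (iterated_dual P2 P1) alpha beta) :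
  exists t : triple P2 P1 alpha beta, hom_of_triple t = m.
Proof.
pose f := dual_fmap (P := Q) m.
have [l [vl [cr mE]]] := span_class_rlegP (lift_cart Q beta f)
  (lift_over Q beta f).
(* The base arrow of [l] starts at the object under the lift of [beta], which equals the source
   required of [tri1] only propositionally. *)
have [g lg] := recast_arr (dual_fmap l)
  (arr_eq_dom (lift_over P2 beta (lift P1 (P2 beta) f)) :
   P2 (lift_ob Q beta f) = lift_ob P1 (P2 beta) f) erefl.
have vg : in_fiber P1 (P1 (P2 alpha)) g.
  exact: arr_eq_trans (fmap_arr_eq P1 (arr_eq_sym lg)) vl.
have [h [vh [cg lE]]] := span_class_rlegP (lift_cart P2 alpha g)
  (arr_eq_trans (lift_over P2 alpha g) (arr_eq_sym lg)).
have vh' : in_fiber P2 (lift_ob P1 (P2 beta) f) h.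
  apply: in_fiber_eq (vh).
  exact: arr_eq_dom (lift_over P2 beta (lift P1 (P2 beta) f)).
exists (Triple vg vh'); rewrite mE; apply/span_class_eqP.
exists (idm _) => /=; split; first exact: iso_id.
  rewrite dual_compm1 lE; congr span_class.
  (* The two inner spans have the same legs and differ only in their proofs of verticality and
     cartesianness. *)
  by rewrite /triple_lleg_span; congr Span; apply: proof_irrelevance.
by rewrite dual_compm1.
Qed.

End Bijection.

Theorem mainTheorem1 (E2 E1 E0 : category)
    (P2 : fibration E2 E1) (P1 : fibration E1 E0) (alpha beta : E2) :
  exists phi : @hom (iterated_dual P2 P1) alpha beta -> triple P2 P1 alpha beta,
    bijective phi /\
    forall m : @hom (iterated_dual P2 P1) alpha beta,
      hom_of_triple (phi m) = m.
Proof.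
(* Surjectivity yields a section of [hom_of_triple]; injectivity makes it a two-sided inverse. *)
pose phi (m : @hom (iterated_dual P2 P1) alpha beta) :=
  sval (constructive_indefinite_description _ (hom_of_triple_surj m)).
have phiK m : hom_of_triple (phi m) = m.
  by rewrite /phi; case: constructive_indefinite_description.
exists phi; split=> //; exists (@hom_of_triple E2 E1 E0 P2 P1 alpha beta) => //.
by move=> t; apply: hom_of_triple_inj; rewrite phiK.
Qed.
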